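(* Let $P$ be a normal logic program and $I$ a three-valued interpretation of $P$. Then $I$ is an L-stable model of $P$ if and only if $I$ is a $\le_u$-minimal stable trap space of $P$, i.e., $I$ is a stable trap space and there is no stable trap space $J$ with $J^{\mathbf{u}}\subsetneq I^{\mathbf{u}}$.
   Context: Fix a first-order language with finitely many constant, function and predicate symbols. A normal logic program (NLP) $P$ is a finite set of rules $p \leftarrow p_1,\dots,p_m, \mathord{\sim} p_{m+1},\dots,\mathord{\sim} p_k$ ($k\ge m\ge 0$). $\mathrm{HB}(P)$ is its Herbrand base (possibly infinite), $\mathrm{gr}(P)$ its ground instantiation; for a ground rule $r$: head $\mathrm{head}(r)$, positive/negative body atoms $B^+(r)$, $B^-(r)$, $\mathrm{bf}(r)=\bigwedge_{v\in B^+(r)}v\wedge\bigwedge_{v\in B^-(r)}\neg v$. A three-valued interpretation is a map $I:\mathrm{HB}(P)\to\{0,1,\star\}$; two-valued ones are identified with subsets of $\mathrm{HB}(P)$. $[I]=\{J\subseteq\mathrm{HB}(P): \forall a,\ I(a)\ne\star\Rightarrow J(a)=I(a)\}$; $I^{\mathbf{u}}=\{a\in\mathrm{HB}(P): I(a)=\star\}$. The preorder $\le_u$: $I_1\le_u I_2$ iff $I_1^{\mathbf{u}}\subseteq I_2^{\mathbf{u}}$. Order $\le_t$: $0<_t\star<_t1$; Kleene evaluation ($\neg\star=\star$, $\wedge$ = $\le_t$-min). $I$ is a three-valued model of a program if $I(\mathrm{bf}(r))\le_t I(\mathrm{head}(r))$ for each ground rule. The reduct $P^I$: from $\mathrm{gr}(P)$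 delete every rule with some $b\in B^-(r)$, $I(b)=1$; delete each $\mathord{\sim}b$ with $I(b)=0$; replace each remaining $\mathord{\sim}b$ by a special atom $\mathbf{u}$ always valued $\star$. $P^I$ has a unique $\le_t$-least three-valued model; $I$ is a stable partial model if it equals it. $I$ is an L-stable model if it is a stable partial model and no stable partial model $J$ has $J^{\mathbf{u}}\subsetneq I^{\mathbf{u}}$. For two-valued $I$, $F_P(I)$ is the $\subseteq$-least model of the Gelfond–Lifschitz reduct (delete rules with some $b\in B^-(r)\cap I$, then delete remaining negative literals). A nonempty set $S$ of two-valued interpretations is a stable trap set if $\{F_P(J):J\in S\}\subseteq S$; a three-valued $I$ is a stable trap space if $[I]$ is a stable trap set. *)

(* Defs.v *)
From HB Require Import structures.
From mathcomp Require Import all_boot.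
From mathcomp Require Import boolp classical_sets functions cardinality.

Set Implicit Arguments.
Unset Strict Implicit.
Unset Printing Implicit Defensive.

Local Open Scope classical_set_scope.

(* Constants are the function symbols of arity 0. *)
Record signature := Signature {
  fsym : finType;
  farity : fsym -> nat;
  psym : finType;
  parity : psym -> nat }.

(* [V] is the type of variables: [nat] in programs, [void] for ground terms
   and atoms, so that [atom L void] is the Herbrand base. *)
Inductive term (L : signature) (V : Type) :=
| Var of V
| App (f : fsym L) of {ffun 'I_(farity f) -> term L V}.

Inductive atom (L : signature) (V : Type) :=
| Atom (p : psym L) of {ffun 'I_(parity p) -> term L V}.

Arguments Var {L V} _.
Arguments App {L V} f _.
Arguments Atom {L V} p _.

Notation HB L := (atom L void).

Fixpoint subst_term L V W (s : V -> term L W) (t : term L V) : term L W :=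
  match t with
  | Var x => s x
  | App f ts => App f [ffun i => subst_term s (ts i)]
  end.

Definition subst_atom L V W (s : V -> term L W) (a : atom L V) : atom L W :=
  let: Atom p ts := a in Atom p [ffun i => subst_term s (ts i)].

(* The rule  head <- pos, ~neg  over an arbitrary type of atoms. *)
Record rule (A : Type) := Rule { rhead : A; rpos : seq A; rneg : seq A }.

Definition map_rule A B (f : A -> B) (r : rule A) : rule B :=
  Rule (f (rhead r)) (map f (rpos r)) (map f (rneg r)).

(* [s] ranges over all substitutions whose result is ground, rather than over
   maps into the ground terms: over a signature without constants there are no
   such maps, although a variable-free rule is its own ground instance. *)
Definition gr L (P : set (rule (atom L nat))) : set (rule (HB L)) :=
  [set g | exists r (s : nat -> term L nat), P r /\
     map_rule (subst_atom s) r = map_rule (subst_atom (of_void _)) g].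

Inductive truth := T0 | TStar | T1.

Definition truth_rank (x : truth) : nat :=
  match x with T0 => 0 | TStar => 1 | T1 => 2 end.

Definition truth_of_rank (n : nat) : truth :=
  match n with 0 => T0 | 1 => TStar | _ => T1 end.

Lemma truth_rankK : cancel truth_rank truth_of_rank.
Proof. by case. Qed.

HB.instance Definition _ := Equality.copy truth (can_type truth_rankK).

Definition tle (x y : truth) : bool := truth_rank x <= truth_rank y.

Definition tand (x y : truth) : truth := if tle x y then x else y.

Definition tneg (x : truth) : truth :=
  match x with T0 => T1 | TStar => TStar | T1 => T0 end.

(* The identification of subsets with two-valued interpretations. *)
Definition ind A (J : set A) (a : A) : truth := if a \in J then T1 else T0.

Definition eval_bf A (I : A -> truth) (r : rule A) : truth :=
  tand (\big[tand/T1]_(a <- rpos r) I a) (\big[tand/T1]_(a <- rneg r) tneg (I a)).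

Definition model A (Q : set (rule A)) (I : A -> truth) : Prop :=
  forall r, Q r -> tle (eval_bf I r) (I (rhead r)).

(* In the three-valued reduct the atoms are [option A]: [None] is the special
   atom u and [Some a] the ordinary atom [a]. *)
Definition with_u A (I : A -> truth) (o : option A) : truth :=
  if o is Some a then I a else TStar.

Definition reduct_rule A (I : A -> truth) (r : rule A) : rule (option A) :=
  Rule (Some (rhead r))
       (map Some (rpos r) ++ [seq None | b <- rneg r & I b != T0]) [::].

Definition reduct A (G : set (rule A)) (I : A -> truth) :
    set (rule (option A)) :=
  [set reduct_rule I r | r in [set r | G r /\ ~~ has (fun b => I b == T1) (rneg r)]].

Definition least_model3 A (Q : set (rule (option A))) (I : A -> truth) : Prop :=
  model Q (with_u I) /\
  forall J : A -> truth, model Q (with_u J) -> forall a, tle (I a) (J a).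

Definition stable_partial_model L (P : set (rule (atom L nat)))
    (I : HB L -> truth) : Prop :=
  least_model3 (reduct (gr P) I) I.

Definition unk A (I : A -> truth) : set A := [set a | I a = TStar].

Definition L_stable_model L (P : set (rule (atom L nat)))
    (I : HB L -> truth) : Prop :=
  stable_partial_model P I /\
  ~ exists J, stable_partial_model P J /\ unk J `<` unk I.

Definition gl_reduct A (G : set (rule A)) (I : set A) : set (rule A) :=
  [set Rule (rhead r) (rpos r) [::] |
     r in [set r | G r /\ ~~ has (fun b => b \in I) (rneg r)]].

(* [F_op P I] is the least two-valued model of the Gelfond-Lifschitz reduct: see
   [F_op_model] and [F_op_least]. *)
Definition F_op L (P : set (rule (atom L nat))) (I : set (HB L)) : set (HB L) :=
  \bigcap_(M in [set M | model (gl_reduct (gr P) I) (ind M)]) M.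

Lemma bigtand_indP A (J : set A) (s : seq A) :
  (\big[tand/T1]_(a <- s) ind J a) =
  if all (fun a => a \in J) s then T1 else T0.
Proof.
elim: s => [|a s IHs]; first by rewrite big_nil.
by rewrite big_cons IHs /= /ind; case: (a \in J); case: (all _ _).
Qed.

Lemma F_op_least L (P : set (rule (atom L nat))) (I M : set (HB L)) :
  model (gl_reduct (gr P) I) (ind M) -> F_op P I `<=` M.
Proof. by move=> mM a; apply. Qed.

Lemma F_op_model L (P : set (rule (atom L nat))) (I : set (HB L)) :
  model (gl_reduct (gr P) I) (ind (F_op P I)).
Proof.
move=> r Qr; have [r0 _ Er] := Qr; move: Qr; rewrite -{}Er => Qr.
rewrite /eval_bf /= big_nil bigtand_indP.
case: ifP => [posF|//]; rewrite /ind; case: ifP => // /negP[].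
apply/mem_set => M mM; apply/set_mem.
have := mM _ Qr; rewrite /eval_bf /= big_nil bigtand_indP.
have -> : all (fun a => a \in M) (rpos r0).
  apply: sub_all posF => a /set_mem aF; apply/mem_set.
  exact: (F_op_least mM) aF.
by rewrite /ind; case: (_ \in M).
Qed.

(* The set written [I] in mathematics. *)
Definition completions A (I : A -> truth) : set (set A) :=
  [set J | forall a, I a <> TStar -> ind J a = I a].

Definition stable_trap_set L (P : set (rule (atom L nat)))
    (S : set (set (HB L))) : Prop :=
  S !=set0 /\ F_op P @` S `<=` S.

Definition stable_trap_space L (P : set (rule (atom L nat)))
    (I : HB L -> truth) : Prop :=
  stable_trap_set P (completions I).

(* Main.v *)
Require Import Defs.
From mathcomp Require Import all_boot.
From mathcomp Require Import boolp classical_sets functions cardinality.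

Local Open Scope classical_set_scope.

(** A three-valued [I] is an interval [[l, u]] of sets, where [l] collects the
    atoms of value 1 and [u] those of value other than 0. The operator
    [F = F_op P] is antitone, so [I] is a stable trap space iff [l <= F u] and
    [F l <= u]; it is a stable partial model iff both are equalities. Every
    stable trap space [[l, u]] contains a stable partial model: take for its
    lower end the least set [m] that contains [l] and is closed under the
    monotone operator [F \o F], and for its upper end [F m]. As [u] is closed
    under [F \o F], [m <= u], hence [l <= F u <= F m]; since [F m] is a fixed
    point of [F \o F], leastness gives [m <= F m]. *)

Definition lower {A} (I : A -> truth) : set A := [set a | I a = T1].
Definition upper {A} (I : A -> truth) : set A := [set a | I a <> T0].

(** With [l] tested first, the lower set is always [l], while the upper set is the union of [l] and
    [u], which is [u] once [l] lies inside it. *)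
Definition interval {A} (l u : set A) (a : A) : truth :=
  if a \in l then T1 else if a \in u then TStar else T0.

(** Cutting the three values above [TStar] and below it turns the order into two Boolean
    implications; the first cut speaks of [lower], the second of [upper]. *)
Lemma tleE x y : tle x y <-> (x = T1 -> y = T1) /\ (x <> T0 -> y <> T0).
Proof. by case: x; case: y; split=> // -[h k]; by [case: (h erefl) | case: k]. Qed.

Lemma lower_le_upper {A} {I : A -> truth} : lower I `<=` upper I.
Proof. by move=> a; rewrite /lower /upper /= => ->. Qed.

Lemma upper_interval {A} {l u : set A} : l `<=` u -> upper (interval l u) = u.
Proof.
move=> lu; apply/seteqP; split=> a; rewrite /upper /interval /=.
  by case: ifPn => [/set_mem/lu//|_]; case: ifPn => // /set_mem.
by move=> /mem_set ->; case: ifP.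
Qed.

Lemma lower_interval A (l u : set A) : lower (interval l u) = l.
Proof.
apply/seteqP; split=> a; rewrite /lower /interval /=.
  by case: ifPn => [/set_mem//|_]; case: ifP.
by move=> /mem_set ->.
Qed.

Lemma unkE A (I : A -> truth) : unk I = upper I `\` lower I.
Proof.
by apply/seteqP; split=> a; rewrite /unk /upper /lower /=; case: (I a) => // -[].
Qed.

Lemma completionsE A (I : A -> truth) :
  completions I = [set J | lower I `<=` J /\ J `<=` upper I].
Proof.
apply/seteqP; split=> J; rewrite /completions /lower /upper /ind /=.
  move=> IJ; split=> a.
    by move=> Ia; move: (IJ a); rewrite Ia; case: ifPn => [/set_mem//|_]; case.
  by move=> /mem_set Ja Ia; move: (IJ a); rewrite Ia Ja => /(_ _)[].
move=> [lJ Ju] a; case Ia: (I a) => // _.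
  by case: ifPn => // /set_mem/Ju.
by rewrite mem_set //; apply: lJ.
Qed.

Lemma in_lower A (I : A -> truth) a : (a \in lower I) = (I a == T1).
Proof. by apply/idP/eqP => [/set_mem|/mem_set]. Qed.

Lemma in_upper A (I : A -> truth) a : (a \in upper I) = (I a != T0).
Proof. by apply/idP/idP => [/set_mem/eqP//|/eqP h]; apply/mem_set. Qed.

Lemma tand_eq1 x y : (tand x y == T1) = (x == T1) && (y == T1).
Proof. by case: x; case: y. Qed.

Lemma tand_neq0 x y : (tand x y != T0) = (x != T0) && (y != T0).
Proof. by case: x; case: y. Qed.

Lemma bigtand_eq1 A (I : A -> truth) s :
  (\big[tand/T1]_(a <- s) I a == T1) = all (fun a => I a == T1) s.
Proof. by elim: s => [|a s IHs]; rewrite ?big_nil// big_cons tand_eq1 IHs. Qed.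

Lemma bigtand_neq0 A (I : A -> truth) s :
  (\big[tand/T1]_(a <- s) I a != T0) = all (fun a => I a != T0) s.
Proof. by elim: s => [|a s IHs]; rewrite ?big_nil// big_cons tand_neq0 IHs. Qed.

Definition gl_closed {A} (G : set (rule A)) (X M : set A) : Prop :=
  forall r, G r -> all (fun b => b \notin X) (rneg r) ->
    all (fun a => a \in M) (rpos r) -> M (rhead r).

Lemma model_gl_reduct A (G : set (rule A)) (X M : set A) :
  model (gl_reduct G X) (ind M) <-> gl_closed G X M.
Proof.
split=> [mM r Gr nX pM | cM _ [r [Gr nX] <-]].
  have := mM (Rule (rhead r) (rpos r) [::]); rewrite /eval_bf /= big_nil.
  rewrite bigtand_indP pM /ind => /(_ _)/=; case: ifP => [/set_mem//|_] H.
  suff: false by [].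
  by apply: H; exists r => //; split; rewrite // -all_predC.
rewrite /eval_bf /= big_nil bigtand_indP; case: ifP => // pM.
by rewrite /ind mem_set//; apply: cM; rewrite // all_predC.
Qed.

(** A reduced body is [T1] iff its positive atoms lie in [lower J] and no atom u is left, so no
    negative atom lies in [upper I]. As u is never [T0], the body is not [T0] iff its positive atoms
    lie in [upper J]; here [lower I] only decides which rules survive. *)
Lemma model_reduct A (G : set (rule A)) (I J : A -> truth) :
  model (reduct G I) (with_u J) <->
  gl_closed G (lower I) (upper J) /\ gl_closed G (upper I) (lower J).
Proof.
have allN r : ~~ has (fun b => I b == T1) (rneg r) =
    all (fun b => b \notin lower I) (rneg r).
  by rewrite -all_predC; apply: eq_all => b /=; rewrite in_lower.
have ev1 r : (eval_bf (with_u J) (reduct_rule I r) == T1) =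
    all (fun a => a \in lower J) (rpos r) &&
    all (fun b => b \notin upper I) (rneg r).
  rewrite /eval_bf big_nil tand_eq1 andbT bigtand_eq1 all_cat all_map.
  congr (_ && _); first by apply: eq_all => a; rewrite in_lower.
  elim: (rneg r) => //= b s IHs; rewrite in_upper negbK.
  by case: eqP.
have ev0 r : (eval_bf (with_u J) (reduct_rule I r) != T0) =
    all (fun a => a \in upper J) (rpos r).
  rewrite /eval_bf big_nil tand_neq0 andbT bigtand_neq0 all_cat all_map.
  rewrite [X in _ && X](_ : _ = true) ?andbT.
    by apply: eq_all => a; rewrite in_upper.
  by rewrite all_map; elim: filter.
split=> [mJ | [cu cl] _ [r [Gr nI] <-]].
  split=> r Gr nI pJ.
    have /mJ/tleE[_] : reduct G I (reduct_rule I r).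
      by exists r => //; split=> //; rewrite allN.
    by apply; apply/eqP; rewrite ev0.
  have /mJ/tleE[+ _] : reduct G I (reduct_rule I r).
    (* The rule survives: its negative atoms avoid [upper I], hence also [lower I]. *)
    exists r => //; split=> //; rewrite allN; apply: sub_all nI => b.
    by apply: contra => /set_mem bl; apply/mem_set; apply: lower_le_upper bl.
  by apply; apply/eqP; rewrite ev1 pJ.
apply/tleE; split=> [/eqP | /eqP].
  by rewrite ev1 => /andP[pJ nu]; apply: cl.
by rewrite ev0 => pJ; apply: cu; rewrite // -allN.
Qed.

Section StableOperator.
Context {L : signature} {P : set (rule (atom L nat))}.
Implicit Types (X Y M : set (HB L)) (I J : HB L -> truth).

Let F := F_op P.

Lemma F_op_closed X : gl_closed (gr P) X (F X).
Proof. exact/model_gl_reduct/F_op_model. Qed.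

Lemma F_op_min X M : gl_closed (gr P) X M -> F X `<=` M.
Proof. by move=> /model_gl_reduct; apply: F_op_least. Qed.

Lemma F_op_antitone {X Y} : X `<=` Y -> F Y `<=` F X.
Proof.
move=> XY; apply: F_op_min => r Gr nY; apply: F_op_closed => //.
by apply: sub_all nY => b; apply: contra => /set_mem/XY/mem_set.
Qed.

(** Both endpoints are completions of [I], and by antitonicity their images bound the images of all
    the others. *)
Lemma stable_trap_spaceE I :
  stable_trap_space P I <-> lower I `<=` F (upper I) /\ F (lower I) `<=` upper I.
Proof.
have lu := @lower_le_upper _ I.
rewrite /stable_trap_space completionsE; split=> [[_ trap] | [lF Fu]].
  have trapF X : lower I `<=` X -> X `<=` upper I ->
      lower I `<=` F X /\ F X `<=` upper I.
    by move=> lX Xu; apply: trap; exists X.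
  by split; [case: (trapF (upper I))|case: (trapF (lower I))].
split; first by exists (lower I); split.
move=> _ [J [lJ Ju] <-]; split.
  exact: subset_trans lF (F_op_antitone Ju).
exact: subset_trans (F_op_antitone lJ) Fu.
Qed.

(** The conditions of [model_reduct] on [lower J] and [upper J] are independent, so the least model
    of the reduct is the interval from [F (upper I)] to [F (lower I)]. *)
Lemma stable_partial_modelE I :
  stable_partial_model P I <-> lower I = F (upper I) /\ upper I = F (lower I).
Proof.
have lu := @lower_le_upper _ I.
split=> [[/model_reduct[cu cl] leastI] | [lF uF]].
  pose K := interval (F (upper I)) (F (lower I)).
  have lK : lower K = F (upper I) := lower_interval _ _ _.
  have uK : upper K = F (lower I) := upper_interval (F_op_antitone lu).
  have /leastI IK : model (reduct (gr P) I) (with_u K).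
    by apply/model_reduct; rewrite lK uK; split; apply: F_op_closed.
  split; apply/seteqP; split; try exact: F_op_min.
    by rewrite -lK => a; case/tleE: (IK a).
  by rewrite -uK => a; case/tleE: (IK a).
split=> [|J /model_reduct[cu cl] a].
  apply/model_reduct; split.
    by rewrite uF; apply: F_op_closed.
  by rewrite lF; apply: F_op_closed.
apply/tleE; split.
  by change (lower I a -> lower J a); rewrite lF; apply: F_op_min.
by change (upper I a -> upper J a); rewrite uF; apply: F_op_min.
Qed.

Lemma stable_partial_model_trap I :
  stable_partial_model P I -> stable_trap_space P I.
Proof. by rewrite stable_trap_spaceE stable_partial_modelE => -[<- <-]; split. Qed.

Lemma stable_trap_space_refine {I} : stable_trap_space P I ->
  exists2 J, stable_partial_model P J & lower I `<=` lower J /\ upper J `<=` upper I.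
Proof.
rewrite stable_trap_spaceE => -[lF Fu].
have lu := @lower_le_upper _ I.
set l := lower I in lF Fu lu *; set u := upper I in lF Fu lu *.
have FF_mono X Y : X `<=` Y -> F (F X) `<=` F (F Y).
  by move=> XY; do 2!apply: F_op_antitone.
pose m := \bigcap_(X in [set X | l `<=` X /\ F (F X) `<=` X]) X.
have m_min X : l `<=` X -> F (F X) `<=` X -> m `<=` X by move=> lX FX a; apply.
have lm : l `<=` m by move=> a la X [lX _]; apply: lX.
have FFm : F (F m) `<=` m.
  by move=> a Fa X [lX FX]; apply: (FX); apply: (FF_mono _ _ _ a Fa); apply: m_min.
have FmE : F (F m) = m.
  apply/seteqP; split=> //; apply: m_min; last exact: FF_mono.
  (* It remains that [l <= F u <= F (F l)], the last step because [F l <= u]. *)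
  apply: subset_trans (FF_mono _ _ lm).
  by apply: subset_trans lF _; apply: F_op_antitone.
(* From [l <= F u] follows [F (F u) <= F l <= u]. *)
have mu : m `<=` u.
  by apply: m_min => //; apply: subset_trans (F_op_antitone lF) _ => //;
    apply: F_op_antitone.
have mFm : m `<=` F m.
  apply: m_min; last by rewrite FmE.
  exact: subset_trans lF (F_op_antitone mu).
exists (interval m (F m)).
  by apply/stable_partial_modelE; rewrite lower_interval upper_interval// FmE.
rewrite lower_interval upper_interval//; split=> //.
exact: subset_trans (F_op_antitone lm) Fu.
Qed.

End StableOperator.

Lemma unk_mono {A} {I J : A -> truth} :
  lower I `<=` lower J -> upper J `<=` upper I -> unk J `<=` unk I.
Proof. by rewrite !unkE => lIJ uJI; apply: setDSS. Qed.

(** Passing to a subinterval keeps every decided value, so it can only change unknown atoms, and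
    these stay unknown by the last hypothesis. *)
Lemma unk_inj A (I J : A -> truth) :
  lower I `<=` lower J -> upper J `<=` upper I -> unk I `<=` unk J -> I = J.
Proof.
move=> lIJ uJI uIJ; apply/funext => a; case Ia: (I a).
- by apply/esym; case Ja: (J a) => //; have := uJI a;
    rewrite /upper /= Ja Ia => /(_ _)[].
- by apply/esym; apply: uIJ.
- by apply/esym; apply: lIJ.
Qed.

Theorem theorem4p10 (L : signature) (P : set (rule (atom L nat)))
    (P_finite : finite_set P) (I : HB L -> truth) :
  L_stable_model P I <->
  (stable_trap_space P I /\
   ~ exists J : HB L -> truth, stable_trap_space P J /\ unk J `<` unk I).
Proof.
split=> -[stI minI].
  (* A trap space [J] with fewer unknowns would contain a stable partial model [K], again with fewer
     unknowns than [I]. *)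
  split=> [|[J [/stable_trap_space_refine[K stK [lJK uKJ]] [JI nIJ]]]].
    exact: stable_partial_model_trap.
  have KJ := unk_mono lJK uKJ; apply: minI; exists K; split=> //.
  split; first exact: subset_trans KJ JI.
  by move=> IK; apply/nIJ/(subset_trans IK).
have [K stK [lIK uKI]] := stable_trap_space_refine stI.
have KI := unk_mono lIK uKI.
(* By minimality [K], itself a trap space inside [I], cannot have fewer unknowns, which forces
   equality. *)
suff E : I = K.
  split; first by rewrite E.
  by move=> [J [stJ JI]]; apply: minI; exists J; split=> //;
    apply: stable_partial_model_trap.
apply: unk_inj => //; apply: contrapT => IK.
by apply: minI; exists K; split; [exact: stable_partial_model_trap|split].
Qed.
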